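(* There are infinitely many integers $n>1$ for which there exist triangle-free graphs $G_1$ and $G_2$, each on $n$ vertices, such that \begin{enumerate} \item $\vartheta(G_1) = \Theta(n^{2/3})$ and $\operatorname{rank}(A_{G_1}+I) = n$; \item $\operatorname{msr}(G_2) \ge n/2$ and $\operatorname{rank}(A_{G_2}+I) = (3/8+o(1))n$, \end{enumerate} where the asymptotic notation refers to $n\to\infty$ along this infinite set of integers.
   Context: All graphs are finite, simple and undirected; $A_G$ is the adjacency matrix of $G$, $I$ the identity matrix, rank is over $\mathbb{R}$. An orthonormal representation of a graph $G$ is an assignment of unit vectors $w_v\in\mathbb{R}^N$ to the vertices $v$ of $G$ such that $\langle w_u,w_v\rangle = 0$ whenever $u\ne v$ are non-adjacent. The Lov\'asz number is $\vartheta(G) = \min_{c,W}\max_{v\in V(G)} \frac{1}{\langle c, w_v\rangle^2}$, the minimum over all orthonormal representations $W=(w_v)$ of $G$ and all unit vectors $c$ (in the same space). The minimum semidefinite rank $\operatorname{msr}(G)$ is the smallest rank of the Gram matrix of an orthonormal representation of $G$ (equivalently, the least dimension $N$ of such a representation). *)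

(* Defs.v *)
From HB Require Import structures.
From mathcomp Require Import all_boot all_order all_algebra.
From mathcomp Require Import all_classical all_reals all_analysis.

Set Implicit Arguments.
Unset Strict Implicit.
Unset Printing Implicit Defensive.

Import Order.TTheory GRing.Theory Num.Theory.
Import numFieldNormedType.Exports.

Local Open Scope classical_set_scope.
Local Open Scope ring_scope.

Record sgraph (n : nat) := SGraph {
  adj :> rel 'I_n;
  adj_sym : symmetric adj;
  adj_irr : irreflexive adj }.

Definition triangle_free n (G : sgraph n) : Prop :=
  forall x y z : 'I_n, ~ (G x y /\ G y z /\ G x z).

Section OrthonormalRepresentations.
Variable R : realType.

Definition adjmx n (G : sgraph n) : 'M[R]_n := \matrix_(i, j) (G i j)%:R.

Definition dot N (u v : 'rV[R]_N) : R := (u *m v^T) 0 0.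

Definition orthonormal_rep n (G : sgraph n) N (w : 'I_n -> 'rV[R]_N) : Prop :=
  (forall v, dot (w v) (w v) = 1) /\
  (forall u v, u != v -> ~~ G u v -> dot (w u) (w v) = 0).

(* Pairs (c, w) with <c, w_v> = 0 for some v have value 1/0 = +oo and do not
   compete in the minimum; they are excluded explicitly because 0^-1 = 0 in
   [R].  All remaining values are positive, so the default 0 of the iterated
   maximum is harmless. *)
Definition lovasz_values n (G : sgraph n) : set R :=
  [set t | exists (N : nat) (c : 'rV[R]_N) (w : 'I_n -> 'rV[R]_N),
    [/\ dot c c = 1, orthonormal_rep G w, (forall v, dot c (w v) != 0)
      & t = \big[Num.max/0]_(v < n) ((dot c (w v)) ^+ 2)^-1]].

(* For n > 0 this infimum is attained (compactness), hence a minimum. *)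
Definition lovasz_theta n (G : sgraph n) : R := inf (lovasz_values G).

Definition gram n N (w : 'I_n -> 'rV[R]_N) : 'M[R]_n :=
  \matrix_(i, j) dot (w i) (w j).

Lemma dot_delta n (i j : 'I_n) :
  dot (delta_mx 0 i) (delta_mx 0 j) = (i == j)%:R.
Proof.
rewrite /dot trmx_delta mul_delta_mx_cond; case: eqP => _.
  by rewrite mulr1n !mxE eqxx.
by rewrite mulr0n mxE.
Qed.

Lemma orthonormal_rep_delta n (G : sgraph n) :
  orthonormal_rep G (fun v => delta_mx 0 v).
Proof.
split=> [v|u v /negbTE uv _]; rewrite dot_delta ?eqxx //.
by rewrite uv.
Qed.

Lemma msr_ex n (G : sgraph n) :
  exists r, `[< exists (N : nat) (w : 'I_n -> 'rV[R]_N),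
                  orthonormal_rep G w /\ \rank (gram w) = r >].
Proof.
exists (\rank (gram (fun v : 'I_n => delta_mx 0 v))); apply/asboolP.
by do 2!eexists; split; first exact: orthonormal_rep_delta.
Qed.

Definition msr n (G : sgraph n) : nat := ex_minn (msr_ex G).

Lemma has_inf_lovasz_values n (G : sgraph n) :
  (0 < n)%N -> has_inf (lovasz_values G).
Proof.
move=> n_gt0; split; last first.
  exists 0 => t [N [c [w [_ _ _ ->]]]].
  by elim/big_ind: _ => // [x y x0 y0|v _]; rewrite ?le_max ?x0 // invr_ge0 sqr_ge0.
have sn : (Num.sqrt n%:R : R) != 0 by rewrite sqrtr_eq0 -ltNge ltr0n.
pose c : 'rV[R]_n := const_mx (Num.sqrt n%:R)^-1.
have cE v : dot c (delta_mx 0 v) = (Num.sqrt n%:R)^-1.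
  by rewrite /dot trmx_delta -colE !mxE.
eexists; exists n, c, (fun v => delta_mx 0 v); split; last reflexivity.
- rewrite /dot mxE (eq_bigr (fun=> (n%:R)^-1)) => [|i _].
    by rewrite sumr_const card_ord -[X in X = _]mulr_natr mulVf // pnatr_eq0 -lt0n.
  by rewrite !mxE -expr2 exprVn sqr_sqrtr.
- exact: orthonormal_rep_delta.
- by move=> v; rewrite cE invr_eq0.
Qed.

End OrthonormalRepresentations.

(* Main.v *)
Require Import Defs.
From mathcomp Require Import all_boot all_order all_algebra.
From mathcomp Require Import all_classical all_reals all_analysis.
From mathcomp Require Import all_field ring lra zify.
From mathcomp.real_closed Require Import mxtens.
From Stdlib Require PeanoNat.
Import Order.TTheory GRing.Theory Num.Theory.
Import numFieldNormedType.Exports.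
Local Open Scope classical_set_scope.
Local Open Scope ring_scope.
Set Implicit Arguments.
Unset Strict Implicit.
Unset Printing Implicit Defensive.

(* [G2] is the tensor product of the Clebsch graph with a complete graph [K_s].
   With [A] the adjacency matrix of the Clebsch graph, [A_{G2} + I] is
   [(I - A) (x) I_s] up to the matrix [A (x) J] of rank at most 16, and
   [I - A] has rank 6 out of 16. Every triangle-free graph has
   [msr >= n / 2]: if [M] is the Gram matrix, [tr (M - I)^3 = 0] and
   [(t - 2)^2 (t + 1) >= 0] for its nonzero eigenvalues [t].

   [G1] lives on the points of an affine part of a generalised quadrangle over
   a field of order [q = 2^k]: every line is split into two halves by a sign
   and carries the complete bipartite graph between them. Triangles of
   collinear points lie on a line, so [G1] is triangle-free. If [N] and [S]
   are the incidence and signed incidence matrices, [2 A = N N^T - S S^T]. For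
   the sign [(-1)^(Tr (x^3 k))], a Fourier transform turns [S S^T] into [q]
   times relations [g x = g y] with [g] a cubic polynomial, so
   [S S^T <= 3 q I], and [2 A + 3 q I] is the Gram matrix of an orthonormal
   representation witnessing [theta = O(q^2)]; the points with [x = 0] form an
   independent set of size [q^2]. Doubling every vertex keeps all this and
   makes [A^2] even, hence [det (A + I)] odd. *)

(** * Dot products, projections and a trace-rank inequality *)

Section DotProduct.
Variable R : realType.

Lemma dotE N (u v : 'rV[R]_N) : dot u v = \sum_i u 0 i * v 0 i.
Proof. by rewrite /dot mxE; apply: eq_bigr => i _; rewrite mxE. Qed.

Lemma dot_sum_sqr N (u : 'rV[R]_N) : dot u u = \sum_i u 0 i ^+ 2.
Proof. by rewrite dotE; apply: eq_bigr => i _; rewrite expr2. Qed.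

Lemma dot_ge0 N (u : 'rV[R]_N) : 0 <= dot u u.
Proof. by rewrite dot_sum_sqr sumr_ge0 // => i _; rewrite sqr_ge0. Qed.

Lemma dot_eq0 N (u : 'rV[R]_N) : dot u u = 0 -> u = 0.
Proof.
move/eqP; rewrite dot_sum_sqr psumr_eq0 => [/allP u0|i _]; last exact: sqr_ge0.
apply/rowP => i; rewrite mxE; apply/eqP; rewrite -sqrf_eq0.
exact: (implyP (u0 i (mem_index_enum i))).
Qed.

Lemma dotC N (u v : 'rV[R]_N) : dot u v = dot v u.
Proof. by rewrite !dotE; apply: eq_bigr => i _; rewrite mulrC. Qed.

Lemma dotDl N (u v w : 'rV[R]_N) : dot (u + v) w = dot u w + dot v w.
Proof. by rewrite /dot mulmxDl mxE. Qed.

Lemma dotNl N (u w : 'rV[R]_N) : dot (- u) w = - dot u w.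
Proof. by rewrite /dot mulNmx mxE. Qed.

Lemma dotZl N a (u w : 'rV[R]_N) : dot (a *: u) w = a * dot u w.
Proof. by rewrite /dot -scalemxAl mxE. Qed.

Lemma dot_suml N (I : finType) (P : pred I) (f : I -> 'rV[R]_N) w :
  dot (\sum_(i | P i) f i) w = \sum_(i | P i) dot (f i) w.
Proof. by rewrite /dot mulmx_suml summxE. Qed.

(** Bessel's inequality: with [p] the projection of [c] onto the span of the orthonormal family, it
    is the nonnegativity of the squared norm of [c - p]. *)
Lemma bessel N (I : finType) (A : {set I}) (c : 'rV[R]_N) (w : I -> 'rV[R]_N) :
  (forall i j, i \in A -> j \in A -> dot (w i) (w j) = (i == j)%:R) ->
  \sum_(i in A) dot c (w i) ^+ 2 <= dot c c.
Proof.
move=> orthoA; pose p := \sum_(i in A) dot c (w i) *: w i.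
have pw i : i \in A -> dot p (w i) = dot c (w i).
  move=> iA; rewrite dot_suml (bigD1 i) //= dotZl orthoA // eqxx mulr1.
  rewrite big1 ?addr0 // => j /andP[jA /negbTE ji].
  by rewrite dotZl orthoA // ji mulr0.
have sumE d : dot p d = \sum_(i in A) dot c (w i) * dot d (w i).
  by rewrite dot_suml; apply: eq_bigr => i _; rewrite dotZl (dotC (w i)).
have pp : dot p p = dot p c.
  by rewrite !sumE; apply: eq_bigr => i /pw ->.
have := dot_ge0 (c - p).
rewrite dotDl dotNl ![dot _ (c - p)]dotC !dotDl !dotNl pp (dotC c p) sumE.
under eq_bigr do rewrite -expr2.
by set s := \sum_(_ in _) _; lra.
Qed.

Lemma mxtrace_mul_tr_ge0 m n (A : 'M[R]_(m, n)) : 0 <= \tr (A *m A^T).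
Proof.
apply: sumr_ge0 => i _; rewrite mxE; apply: sumr_ge0 => j _.
by rewrite mxE -expr2 sqr_ge0.
Qed.

Lemma row_free_mul_tr m n (A : 'M[R]_(m, n)) :
  row_free A -> A *m A^T \in unitmx.
Proof.
move=> Afree; rewrite -row_free_unit -kermx_eq0; apply/eqP/row_matrixP => i.
rewrite row0; set u := row i _.
have uA : u *m A = 0.
  apply: dot_eq0; rewrite /dot trmx_mul mulmxA -(mulmxA u).
  have /sub_kermxP -> : (u <= kermx (A *m A^T))%MS by exact: row_sub.
  by rewrite mul0mx mxE.
by apply: (row_free_inj Afree); rewrite uA mul0mx.
Qed.

(** For a row basis [Q] of [M], the projector onto the row space is [Q^T (Q Q^T)^-1 Q]; cyclicity of
    the trace identifies its trace with the number of rows of [Q]. *)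
Lemma orthogonal_projector m n (M : 'M[R]_(m, n)) :
  exists P : 'M[R]_n, [/\ P^T = P, P *m P = P, M *m P = M
    & \tr P = (\rank M)%:R].
Proof.
have [r [Q [Qfree MQ ->]]] : exists r (Q : 'M[R]_(r, n)),
    [/\ row_free Q, (M <= Q)%MS & \rank M = r].
  by exists (\rank M), (row_base M); rewrite row_base_free eq_row_base.
have QQ := row_free_mul_tr Qfree; pose K := invmx (Q *m Q^T).
have QP : Q *m (Q^T *m K *m Q) = Q by rewrite !mulmxA mulmxV // mul1mx.
exists (Q^T *m K *m Q); split.
- by rewrite !trmx_mul trmxK /K trmx_inv trmx_mul trmxK mulmxA.
- by rewrite -mulmxA QP.
- by have /submxP[X ->] := MQ; rewrite -(mulmxA X) QP.
- by rewrite mxtrace_mulC mulmxA mulmxV // mxtrace1.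
Qed.

(* Every nonzero eigenvalue [t] of [W W^T] satisfies [t^3 - 3 t^2 + 4 =
   (t - 2)^2 (t + 1) >= 0]; here the inequality is summed over all of them. *)
Lemma mxtrace_gram_rank m n (W : 'M[R]_(m, n)) (M := W *m W^T) :
  0 <= \tr (M *m M *m M) - 3 * \tr (M *m M) + 4 * (\rank M)%:R.
Proof.
have MT : M^T = M by rewrite trmx_mul trmxK.
have [P [PT PP MP trP]] := orthogonal_projector M.
have PM : P *m M = M by rewrite -MT -PT -trmx_mul MP.
(* As [P] is the identity on the row space of [M], [B] acts there as [M - 2]; the traces of [B M B]
   and [B P B] are the sums of [t (t - 2)^2] and [(t - 2)^2] over the nonzero eigenvalues [t]. *)
pose B := M - P - P.
have BT : B^T = B by rewrite !linearB /= MT PT.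
have h1 : 0 <= \tr (B *m M *m B).
  have -> : B *m M *m B = (B *m W) *m (B *m W)^T by rewrite trmx_mul BT !mulmxA.
  exact: mxtrace_mul_tr_ge0.
have h2 : 0 <= \tr (B *m P *m B).
  have -> : B *m P *m B = (B *m P) *m (B *m P)^T.
    by rewrite trmx_mul BT PT mulmxA -(mulmxA B P P) PP.
  exact: mxtrace_mul_tr_ge0.
have BM : B *m M = M *m M - M - M by rewrite !mulmxBl PM.
have BP : B *m P = M - P - P by rewrite !mulmxBl PP MP.
move: h1 h2; rewrite BM BP !(mulmxBl, mulmxBr) PM MP PP -(mulmxA M M P) MP.
by rewrite !linearB /= trP; lra.
Qed.

End DotProduct.

(** * Lower bounds for msr and for the Lovasz number *)

Section TriangleFree.
Variable R : realType.

Lemma gramE n N (w : 'I_n -> 'rV[R]_N) :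
  gram w = (\matrix_i w i) *m (\matrix_i w i)^T.
Proof.
apply/matrixP => i j; rewrite !mxE dotE; apply: eq_bigr => k _.
by rewrite !mxE.
Qed.

(** Expanding [tr (M - I)^3 = 0] with [tr M = n] gives [tr M^3 - 3 tr M^2 = - 2 n], so
    [mxtrace_gram_rank] becomes [2 n <= 4 rank M]. *)
Lemma msr_triangle_free n (G : sgraph n) :
  triangle_free G -> n%:R / 2 <= (msr R G)%:R :> R.
Proof.
move=> tfG; rewrite /msr; case: ex_minnP => r /asboolP[N [w [[w1 w0] <-]]] _.
have := mxtrace_gram_rank (\matrix_i w i); rewrite -gramE; set M := gram w.
have trM : \tr M = n%:R.
  rewrite /mxtrace (eq_bigr (fun=> 1)) => [|i _]; last by rewrite mxE w1.
  by rewrite sumr_const card_ord.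
(* The diagonal of [M - 1%:M] is zero, so a nonzero term of the trace would need three mutually
   adjacent vertices. *)
have trA : \tr ((M - 1%:M) *m (M - 1%:M) *m (M - 1%:M)) = 0.
  apply: big1 => i _; rewrite mxE; apply: big1 => j _.
  rewrite mxE mulr_suml; apply: big1 => k _.
  rewrite !mxE (eq_sym k j).
  have [<-|ik] := eqVneq i k; first by rewrite w1 subrr !mul0r.
  have [<-|jk] := eqVneq j k; first by rewrite dotC w1 subrr mulr0 mul0r.
  have [<-|ji] := eqVneq j i; first by rewrite w1 subrr mulr0.
  rewrite !subr0.
  case: (boolP (G i k)) => [Gik|]; last by move/w0 ->; rewrite ?mul0r.
  case: (boolP (G k j)) => [Gkj|nG]; last first.
    by rewrite (w0 k j) 1?eq_sym ?mulr0 ?mul0r.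
  case: (boolP (G j i)) => [Gji|]; last by move/w0 ->; rewrite ?mulr0.
  by case: (tfG i k j); rewrite adj_sym in Gji.
move: trA; rewrite !(mulmxBl, mulmxBr, mulmx1, mul1mx) !linearB /= trM mxtrace1.
set d := \rank M; set t3 := \tr (M *m M *m M); set t2 := \tr (M *m M).
by lra.
Qed.

(** The vectors of an independent set are orthonormal, so by Bessel their squared products with the
    unit vector [c] sum to at most 1, while each is at least the inverse of the value. *)
Lemma lovasz_theta_ge_independent n (G : sgraph n) (A : {set 'I_n}) :
  (0 < n)%N -> (forall u v, u \in A -> v \in A -> ~~ G u v) ->
  #|A|%:R <= lovasz_theta R G.
Proof.
move=> n_gt0 indepA; apply: lb_le_inf.
  by have [] := has_inf_lovasz_values R G n_gt0.
move=> t [N [c [w [c1 [w1 w0] cw ->]]]]; set t' := \big[_/_]_(_ < n) _.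
have [->|[a aA]] := set_0Vmem A.
  rewrite cards0; elim/big_ind: t' => // [x y x0 _|v _]; first by rewrite le_max x0.
  by rewrite invr_ge0 sqr_ge0.
have t'P v : (dot c (w v) ^+ 2)^-1 <= t' by exact: le_bigmax_cond.
have sqr_gt0 v : 0 < dot c (w v) ^+ 2 by rewrite exprn_even_gt0 //= cw.
have t'_gt0 : 0 < t' by apply: lt_le_trans (t'P a); rewrite invr_gt0.
rewrite -(ler_pM2r (x := t'^-1)) ?invr_gt0 // divff ?gt_eqF //.
have /le_trans : \sum_(v in A) dot c (w v) ^+ 2 <= dot c c.
  apply: bessel => u v uA vA; have [<-|uv] := eqVneq; first exact: w1.
  by rewrite w0 // indepA.
rewrite c1; move/(_ 1 (lexx _)); apply: le_trans.
rewrite -sum1_card natr_sum mulr_suml; apply: ler_sum => v _.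
by rewrite mul1r invf_ple ?posrE.
Qed.

End TriangleFree.

(** * The Clebsch graph and its spectral decomposition *)

(** Cayley graph of [(Z/2)^4], elements being coded by binary digits: the generators are the four
    unit vectors and the all-ones vector. *)
Definition clebsch (x y : 'I_16) : bool :=
  Nat.lxor x y \in [:: 1; 2; 4; 8; 15]%N.

Definition parity4 (m : nat) : bool :=
  foldr (fun i b => Nat.testbit m i (+) b) false [:: 0; 1; 2; 3]%N.

(* The characters of [(Z/2)^4] on which the Clebsch graph has an eigenvalue
   different from [1]: the trivial one (eigenvalue 5), and those given by the
   masks of weight at least 3 (eigenvalue -3). *)
Definition clebsch_chi (x : nat) (a : nat) : int :=
  if parity4 (Nat.land x (nth 0 [:: 0; 7; 11; 13; 14; 15] a)%N) then -1 else 1.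

Definition clebsch_sgn (a : nat) : int := if a is 0%N then -1 else 1.

Definition clebsch_X : 'M[int]_(16, 6) := \matrix_(i, j) clebsch_chi i j.
Definition clebsch_Y : 'M[int]_(16, 6) :=
  \matrix_(i, j) (clebsch_chi i j * clebsch_sgn j).
Definition clebsch_mx : 'M[int]_16 := \matrix_(i, j) (clebsch i j)%:R.

Lemma forall_ordP n (P : nat -> bool) :
  all P (iota 0 n) -> forall i : 'I_n, P i.
Proof. by move/allP => Pn i; apply: Pn; rewrite mem_iota /=. Qed.

Lemma clebsch_sym : symmetric clebsch.
Proof. by move=> x y; rewrite /clebsch PeanoNat.Nat.lxor_comm. Qed.

Lemma clebsch_irr : irreflexive clebsch.
Proof. by move=> x; rewrite /clebsch PeanoNat.Nat.lxor_nilpotent. Qed.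

(** The connection set is sum-free, which is checked by computation. *)
Lemma clebsch_triangle_free x y z :
  ~ [/\ clebsch x y, clebsch y z & clebsch x z].
Proof.
move=> [xy yz]; rewrite /clebsch.
have -> : Nat.lxor x z = Nat.lxor (Nat.lxor x y) (Nat.lxor y z).
  rewrite PeanoNat.Nat.lxor_assoc -(PeanoNat.Nat.lxor_assoc y y).
  by rewrite PeanoNat.Nat.lxor_nilpotent PeanoNat.Nat.lxor_0_l.
move: xy yz; rewrite /clebsch; set S := [:: _; _; _; _; _].
move: (Nat.lxor x y) (Nat.lxor y z) => a b aS bS; apply/negP.
have : all (fun a => all (fun b => Nat.lxor a b \notin S) S) S by vm_compute.
by move=> /allP/(_ a aS)/allP/(_ b bS).
Qed.

(** Each character contributes [(1 - t) / 16] times its rank-one matrix to [I - A], where [t] is its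
    eigenvalue; [1 - t] is -4 for [t = 5], 4 for [t = -3] and 0 for [t = 1]. *)
Lemma clebsch_factor : 4 *: (1%:M - clebsch_mx) = clebsch_Y *m clebsch_X^T.
Proof.
apply/matrixP => i j; rewrite !mxE.
under eq_bigr do rewrite !mxE.
rewrite -(big_mkord xpredT (fun k => clebsch_chi i k * clebsch_sgn k *
   clebsch_chi j k)) unlock.
apply/eqP; rewrite -val_eqE; move: i j.
(* Restating the entries as [foldr] over natural numbers lets [vm_compute] check all pairs. *)
pose P i j := 4 * ((i == j)%:R - (Nat.lxor i j \in [:: 1; 2; 4; 8; 15]%N)%:R) ==
  foldr (fun k s => clebsch_chi i k * clebsch_sgn k * clebsch_chi j k + s)
    (0 : int) (iota 0 6).
suff PP : all (fun i => all (P i) (iota 0 16)) (iota 0 16).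
  by move=> i j; exact: (forall_ordP (forall_ordP PP i)).
by vm_compute.
Qed.

(** By orthogonality of characters, [X^T Y] is 16 times a diagonal sign matrix. This shows that the
    factorisation has full rank 6. *)
Lemma clebsch_invol :
  clebsch_X^T *m clebsch_Y *m (clebsch_X^T *m clebsch_Y) = 256%:M.
Proof.
have XY : clebsch_X^T *m clebsch_Y =
    \matrix_(i, j) (16 * clebsch_sgn j * (i == j)%:R).
  apply/matrixP => i j; rewrite !mxE.
  under eq_bigr do rewrite !mxE.
  rewrite -(big_mkord xpredT (fun k => clebsch_chi k i * (clebsch_chi k j *
     clebsch_sgn j))) unlock.
  apply/eqP; rewrite -val_eqE; move: i j.
  pose P i j := foldr (fun k s => clebsch_chi k i * (clebsch_chi k j *
    clebsch_sgn j) + s) (0 : int) (iota 0 16) ==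
    16 * clebsch_sgn j * (i == j)%:R.
  suff PP : all (fun i => all (P i) (iota 0 6)) (iota 0 6).
    by move=> i j; exact: (forall_ordP (forall_ordP PP i)).
  by vm_compute.
apply/matrixP => i j; rewrite XY !mxE (bigD1 i) //= big1 ?addr0 => [|k ki].
  rewrite !mxE eqxx mulr1; have [<-|] := eqVneq; last by rewrite !mulr0.
  by rewrite mulr1 /clebsch_sgn; case: (nat_of_ord i).
by rewrite !mxE eq_sym (negbTE ki) mulr0 mul0r.
Qed.

(** * The tensor product with a complete graph and its rank *)

Section TensorClebsch.
Variables (R : realType) (s : nat).

Definition tensor_clebsch_adj (i j : 'I_(16 * s)) : bool :=
  clebsch (mxtens_unindex i).1 (mxtens_unindex j).1 &&
  ((mxtens_unindex i).2 != (mxtens_unindex j).2).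

Lemma tensor_clebsch_sym : symmetric tensor_clebsch_adj.
Proof. by move=> i j; rewrite /tensor_clebsch_adj clebsch_sym eq_sym. Qed.

Lemma tensor_clebsch_irr : irreflexive tensor_clebsch_adj.
Proof. by move=> i; rewrite /tensor_clebsch_adj clebsch_irr. Qed.

Definition tensor_clebsch := SGraph tensor_clebsch_sym tensor_clebsch_irr.

Lemma tensor_clebsch_triangle_free : triangle_free tensor_clebsch.
Proof.
move=> x y z [/andP[xy _] [/andP[yz _] /andP[xz _]]].
by apply: clebsch_triangle_free; split; [exact: xy|exact: yz|exact: xz].
Qed.

Let A : 'M[R]_16 := map_mx intr clebsch_mx.
Let X : 'M[R]_(16, 6) := map_mx intr clebsch_X.
Let Y : 'M[R]_(16, 6) := map_mx intr clebsch_Y.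

Lemma tensor_clebsch_mx : adjmx R tensor_clebsch + 1%:M =
  A *t const_mx 1 + (1%:M - A) *t 1%:M.
Proof.
apply/matrixP => i j; rewrite !mxE.
rewrite -[tensor_clebsch i j]/(tensor_clebsch_adj i j) /tensor_clebsch_adj.
rewrite -(can_eq (@mxtens_unindexK 16 s) i j).
case: (mxtens_unindex i) (mxtens_unindex j) => [a b] [c d] /=.
rewrite xpair_eqE; case: (clebsch a c); case: (a == c); case: (b == d) => /=;
  rewrite ?(mulr1n, mulr0n, mulr1z, mulr0z); ring.
Qed.

Lemma rank_tensor_clebsch :
  (6 * s <= \rank (adjmx R tensor_clebsch + 1%:M)%R + 16)%N /\
  (\rank (adjmx R tensor_clebsch + 1%:M)%R <= 6 * s + 16)%N.
Proof.
pose E : 'M[R]_(16 * s) := (1%:M - A) *t 1%:M.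
pose B : 'M[R]_(16 * s) := A *t const_mx 1.
have E4 : 4 *: E = (Y *t 1%:M) *m (X^T *t 1%:M).
  rewrite tensmx_mul mulmx1 map_trmx -map_mxM -clebsch_factor.
  apply/matrixP => i j; rewrite !mxE rmorphM rmorphB /= mulrA.
  by rewrite !rmorph_nat.
have rE : \rank E = (6 * s)%N.
  rewrite -(mxrank_scale_nz _ (_ : 4 != 0)) ?pnatr_eq0 // E4.
  apply/eqP; rewrite eqn_leq mulmx_max_rank /=.
  (* Lower bound: multiplying the factorised [4 *: E] by [X^T *t 1%:M] on the left and [Y *t 1%:M]
     on the right yields the invertible scalar matrix 256 of size [6 * s]. *)
  have : \rank (256%:M : 'M[R]_(6 * s)) = (6 * s)%N.
    by rewrite mxrank_unit // unitmxE det_scalar unitfE expf_neq0 ?pnatr_eq0.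
  move=> {1}<-.
  have -> : 256%:M = (X^T *t 1%:M) *m ((Y *t 1%:M) *m (X^T *t 1%:M)) *m
      (Y *t 1%:M) :> 'M[R]_(6 * s).
    rewrite !tensmx_mul !mulmx1 !mulmxA -(mulmxA _ X^T).
    rewrite map_trmx -!map_mxM clebsch_invol map_scalar_mx.
    apply/matrixP => i j; rewrite !mxE -(can_eq (@mxtens_unindexK 6 s) i j).
    case: (mxtens_unindex i) (mxtens_unindex j) => [a b] [c d].
    rewrite xpair_eqE /=; case: (a == c); case: (b == d) => /=;
      by rewrite ?mulr1n ?mulr0n ?mulr1 ?mulr0.
  by apply: leq_trans (mxrankM_maxl _ _) _; exact: mxrankM_maxr.
have rB : (\rank B <= 16)%N.
  have -> : B = (A *t (const_mx 1 : 'cV[R]_s)) *m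
      (1%:M *t (const_mx 1 : 'rV[R]_s)).
    rewrite tensmx_mul mulmx1; congr (_ *t _); apply/matrixP => i j.
    by rewrite !mxE big_ord_recl big_ord0 !mxE mulr1 addr0.
  by apply: leq_trans (mulmx_max_rank _ _) _.
rewrite tensor_clebsch_mx -/E -/B; split.
  rewrite -rE; have {1}-> : E = (B + E) + (- B) by rewrite addrC addKr.
  by apply: leq_trans (mxrank_add _ _) _; rewrite leq_add2l mxrank_opp.
by apply: leq_trans (mxrank_add _ _) _; rewrite addnC rE leq_add2l.
Qed.

End TensorClebsch.

(** * A nontrivial additive sign on a field of characteristic 2 *)

(** The sign is the absolute trace [T]. It is additive by Frobenius, and [T x ^+ 2 = T x] puts its
    values in 0 and 1. It is not identically 0, since as a nonzero polynomial of degree below [#|F|]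
    it cannot vanish on all of [F]. *)
Lemma exists_additive_sign (F : finFieldType) k :
  2%N \in [pchar F] -> #|F| = (2 ^ k)%N ->
  exists2 e : F -> bool, {morph e : x y / x + y >-> x (+) y} & exists z, e z.
Proof.
move=> ch2 cardF; pose T (x : F) := \sum_(i < k) x ^+ (2 ^ i).
have TD : {morph T : x y / x + y}.
  move=> x y; rewrite /T -big_split; apply: eq_bigr => i _ /=.
  by rewrite exprDn_pchar // pnatX (pnatE _ (pcharf_prime ch2)) ch2.
have k_gt0 : (0 < k)%N.
  by case: k cardF {T TD} => // cF; have := finNzRing_gt1 F; rewrite cF.
have T01 x : (T x == 0) || (T x == 1).
  have sqrD (n : nat) (f : 'I_n -> F) : (\sum_i f i) ^+ 2 = \sum_i f i ^+ 2.
    elim: n f => [|n IH] f; first by rewrite !big_ord0 expr0n.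
    rewrite !big_ord_recl sqrrD IH -mulr_natl.
    by rewrite (pcharf0 ch2) mul0r addr0.
  have : T x ^+ 2 = T x.
    rewrite sqrD /T; under eq_bigr do rewrite -exprM -expnSr.
    move: (expf_card x); rewrite cardF; case: k k_gt0 {cardF T TD sqrD} => // k' _ xk.
    by rewrite big_ord_recr /= xk addrC big_ord_recl /= expn0 expr1.
  move/eqP; rewrite -subr_eq0 expr2 -{3}[T x]mulr1 -mulrBr mulf_eq0.
  by rewrite subr_eq0.
exists (fun x => T x == 1) => [x y|].
  rewrite TD; move: (T01 x) (T01 y).
  have [->|_] := eqVneq (T x) 1; have [->|_] := eqVneq (T y) 1;
    rewrite ?orbT ?orbF => //= /eqP.
  - by move=> _; rewrite (addrr_pchar2 ch2) eq_sym oner_eq0.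
  - by move=> _ /eqP ->; rewrite addr0 eqxx.
  - by move=> -> _; rewrite add0r eqxx.
  - by move=> -> /eqP ->; rewrite addr0 eq_sym oner_eq0.
apply/existsP; rewrite -[[exists _, _]]negbK negb_exists; apply/negP => /forallP T0.
pose p : {poly F} := \sum_(i < k) 'X^(2 ^ i).
have p_neq0 : p != 0.
  apply/eqP => /(congr1 (fun r : {poly F} => r`_1)); rewrite coef0 coef_sum.
  rewrite (bigD1 (Ordinal k_gt0)) //= coefXn expn0 big1 ?addr0 => [/eqP|i i0].
    by rewrite oner_eq0.
  rewrite coefXn eq_sym -[1%N](expn0 2) eqn_exp2l //.
  by case: eqP => // /eqP i0'; rewrite -val_eqE /= i0' in i0.
have /(max_poly_roots p_neq0) : all (root p) (enum F).
  apply/allP => x _; rewrite /root horner_sum.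
  under eq_bigr do rewrite hornerXn.
  by have := T01 x; rewrite (negbTE (T0 x)) orbF.
rewrite enum_uniq -cardT cardF => /(_ isT); apply/negP; rewrite -leqNgt.
apply: (leq_trans (size_sum _ _ _)); apply/bigmax_leqP => i _.
by rewrite size_polyXn ltn_exp2l.
Qed.

(** * Graphs on finite types and upper bounds for the Lovasz number *)

Definition fgraph (V : finType) (e : rel V) (es : symmetric e)
    (ei : irreflexive e) : sgraph #|V| :=
  @SGraph #|V| (fun i j => e (enum_val i) (enum_val j))
    (fun i j => es _ _) (fun i => ei _).

Lemma sum_enum_val (I : finType) (S : nmodType) (f : I -> S) :
  \sum_(i < #|I|) f (enum_val i) = \sum_i f i.
Proof. by rewrite [RHS](reindex _ (onW_bij _ (enum_val_bij I))). Qed.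

Section FinVec.
Variable R : realType.

Definition finvec (I : finType) (f : I -> R) : 'rV[R]_#|I| :=
  \row_i f (enum_val i).

Lemma dot_finvec (I : finType) (f g : I -> R) :
  dot (finvec f) (finvec g) = \sum_i f i * g i.
Proof.
by rewrite dotE -[RHS]sum_enum_val; apply: eq_bigr => i _; rewrite !mxE.
Qed.

(** Dividing [W] by [sqrt D] and [C] by [sqrt S] gives unit vectors whose products with the handle
    all equal [K / sqrt (D S)], so all vertices have the same value. *)
Lemma lovasz_theta_le (V I : finType) (e : rel V) (es : symmetric e)
    (ei : irreflexive e) (W : V -> I -> R) (C : I -> R) (D S K : R) :
  0 < D -> 0 < S -> 0 < K -> (0 < #|V|)%N ->
  (forall p, \sum_i W p i ^+ 2 = D) ->
  (forall p p', p != p' -> ~~ e p p' -> \sum_i W p i * W p' i = 0) ->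
  \sum_i C i ^+ 2 = S -> (forall p, \sum_i C i * W p i = K) ->
  lovasz_theta R (fgraph es ei) <= D * S / K ^+ 2.
Proof.
move=> D0 S0 K0 V0 WD We CS CW; apply: ge_inf.
  by have [] := has_inf_lovasz_values R (fgraph es ei) V0.
pose c := (Num.sqrt S)^-1 *: finvec C.
pose w (i : 'I_#|V|) := (Num.sqrt D)^-1 *: finvec (W (enum_val i)).
have dotZ N a b (u v : 'rV[R]_N) : dot (a *: u) (b *: v) = a * b * dot u v.
  by rewrite dotZl dotC dotZl dotC mulrA.
have cw v : dot c (w v) = (Num.sqrt S)^-1 * (Num.sqrt D)^-1 * K.
  by rewrite dotZ dot_finvec CW.
have sqrtV2 x : 0 < x -> (Num.sqrt x)^-1 ^+ 2 = x^-1 :> R.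
  by move=> x0; rewrite exprVn sqr_sqrtr // ltW.
have cc : dot c c = 1.
  rewrite dotZ -expr2 dot_finvec sqrtV2 //.
  by under eq_bigr do rewrite -expr2; rewrite CS mulVf // gt_eqF.
exists _, c, w; split => //.
- split=> [v|u v uv Guv].
    rewrite dotZ -expr2 dot_finvec sqrtV2 //.
    by under eq_bigr do rewrite -expr2; rewrite WD mulVf // gt_eqF.
  by rewrite dotZ dot_finvec We ?mulr0 // (inj_eq enum_val_inj).
- by move=> v; rewrite cw !mulf_neq0 ?invr_eq0 ?gt_eqF ?sqrtr_gt0.
- have E v : (dot c (w v) ^+ 2)^-1 = D * S / K ^+ 2.
    rewrite cw !exprMn !sqrtV2 // !invfM !invrK; ring.
  under eq_bigr do rewrite E.
  have v0 : 'I_#|V| by exact: Ordinal V0.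
  apply/eqP; rewrite eq_le; apply/andP; split.
    by rewrite (@le_bigmax_cond _ _ _ _ v0 xpredT (fun=> D * S / K ^+ 2)).
  by apply/bigmax_leP; split=> // ; rewrite divr_ge0 ?sqr_ge0 ?mulr_ge0 // ltW.
Qed.

End FinVec.

(** * Doubling vertices forces full rank *)

Section Twins.
Variables (V : finType) (e : rel V).
Hypotheses (es : symmetric e) (ei : irreflexive e).

Definition twin_rel : rel (V * bool) := fun p p' => e p.1 p'.1.

Lemma twin_sym : symmetric twin_rel. Proof. by move=> p p'; exact: es. Qed.

Lemma twin_irr : irreflexive twin_rel. Proof. by move=> p; exact: ei. Qed.

Definition twin_graph := fgraph twin_sym twin_irr.

(* Twins make all common neighbourhoods even, so [(A + 1)^2 = 1] modulo 2 and
   [\det (A + 1)] is odd. *)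
Lemma rank_twin_graph (R : realType) :
  \rank (adjmx R twin_graph + 1%:M)%R = #|{: V * bool}|.
Proof.
pose M (S : pzRingType) : 'M[S]_#|{: V * bool}| :=
  \matrix_(i, j) (twin_graph i j)%:R + 1%:M.
have mapM (S : nzRingType) : map_mx intr (M int) = M S.
  by apply/matrixP => i j; rewrite !mxE rmorphD /= !rmorph_nat.
have M2 : M 'F_2 *m M 'F_2 = 1%:M.
  rewrite /M; set B := \matrix_(i, j) _.
  have B2 : B *m B = 0.
    apply/matrixP => i j; rewrite !mxE.
    under eq_bigr do rewrite !mxE.
    rewrite (sum_enum_val (fun p => (e (enum_val i).1 p.1)%:R *
      (e p.1 (enum_val j).1)%:R)).
    rewrite -(pair_bigA _ (fun x (_ : bool) => (e (enum_val i).1 x)%:R *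
      (e x (enum_val j).1)%:R)) big1 //= => x _.
    by rewrite big_bool /= (addrr_pchar2 (pchar_Fp _)).
  have BB : B + B = 0.
    by apply/matrixP => i j; rewrite !mxE (addrr_pchar2 (pchar_Fp _)).
  by rewrite mulmxDl !mulmxDr mul1mx !mulmx1 B2 add0r addrA BB add0r.
have detZ : \det (M int) != 0.
  apply/eqP => d0; have := congr1 (fun X => \det X) M2.
  by rewrite -mapM det_mulmx det_map_mx d0 det1 rmorph0 mul0r.
rewrite mxrank_unit // unitmxE unitfE -[_ + _]/(M R) -mapM det_map_mx.
by rewrite intr_eq0.
Qed.

End Twins.

(** * Gram factors from Laplacians of equivalence relations *)

Section FiberLaplacian.
Variables (R : realType) (T : finType) (U : eqType) (d : nat) (g : T -> U).

(* A Gram factor of [d I - E], where [E] is the equivalence relation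
   [g x == g y]: on each class this is a Laplacian plus a multiple of [I]. *)
Definition fiber_laplacian (x : T) (i : T * T) : R :=
  (i.1 == i.2)%:R * (x == i.1)%:R *
    Num.sqrt (d - #|[pred b | g b == g i.1]|)%N%:R +
  (g i.1 == g i.2)%:R * ((x == i.1)%:R - (x == i.2)%:R) / Num.sqrt 2.

Lemma gram_fiber_laplacian x y :
  (forall a, (#|[pred b | g b == g a]| <= d)%N) ->
  \sum_i fiber_laplacian x i * fiber_laplacian y i =
    d%:R * (x == y)%:R - (g x == g y)%:R.
Proof.
move=> card_d; pose cl a := [pred b | g b == g a].
(* [f1] is the diagonal correction, [f2] the degree part of the Laplacian and [f3] its adjacency
   part; every unordered pair occurs in both orders, whence the division by 2. *)
pose f1 a b : R := (a == b)%:R * ((x == a)%:R * (y == a)%:R *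
   (d%:R - #|cl a|%:R)).
pose f2 a b : R := (g a == g b)%:R * ((x == a)%:R * (y == a)%:R).
pose f3 a b : R := (x == a)%:R * (y == b)%:R * (g a == g b)%:R.
have t2 : (Num.sqrt 2)^-1 ^+ 2 = 2^-1 :> R by rewrite exprVn sqr_sqrtr.
have E i : fiber_laplacian x i * fiber_laplacian y i =
    f1 i.1 i.2 + (f2 i.1 i.2 + f2 i.2 i.1 - (f3 i.1 i.2 + f3 i.2 i.1)) / 2.
  case: i => a b; rewrite /fiber_laplacian /f1 /f2 /f3 /=.
  have [<-|ab] := eqVneq a b.
    (* The bound on class sizes keeps the natural subtraction from truncating. *)
    have sd : Num.sqrt (d - #|cl a|)%N%:R ^+ 2 = d%:R - #|cl a|%:R :> R.
      by rewrite sqr_sqrtr ?ler0n // natrB ?card_d.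
    rewrite !subrr !mulr0 !mul0r !addr0 !mul1r -sd eqxx.
    by rewrite /cl; ring.
  rewrite !mul0r !add0r (eq_sym (g b)).
  rewrite -t2; case: (g a == g b); rewrite ?mulr1n ?mulr0n; ring.
under eq_bigr do rewrite E.
rewrite -(pair_bigA _ (fun a b => f1 a b +
  (f2 a b + f2 b a - (f3 a b + f3 b a)) / 2)) /=.
have sum_delta (z : T) (h : T -> R) : \sum_a (z == a)%:R * h a = h z.
  rewrite (bigD1 z) //= eqxx mul1r big1 ?addr0 // => a za.
  by rewrite eq_sym (negbTE za) mul0r.
have S1 : \sum_a \sum_b f1 a b = (x == y)%:R * (d%:R - #|cl x|%:R).
  under eq_bigr do rewrite sum_delta -mulrA.
  by rewrite sum_delta eq_sym.
have S2 : \sum_a \sum_b f2 a b = (x == y)%:R * #|cl x|%:R.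
  under eq_bigr do rewrite -mulr_suml mulrC -mulrA.
  rewrite sum_delta eq_sym; congr (_ * _).
  rewrite -natr_sum -sum1_card [in RHS]big_mkcond; congr _%:R.
  by apply: eq_bigr => b _; rewrite inE eq_sym; case: (_ == _).
have S3 : \sum_a \sum_b f3 a b = (g x == g y)%:R.
  rewrite -(sum_delta x (fun a => (g a == g y)%:R)); apply: eq_bigr => a _.
  rewrite -(sum_delta y (fun b => (g a == g b)%:R)) mulr_sumr.
  by apply: eq_bigr => b _; rewrite /f3 mulrA.
have S2' : \sum_a \sum_b f2 b a = \sum_a \sum_b f2 a b by rewrite exchange_big.
have S3' : \sum_a \sum_b f3 b a = \sum_a \sum_b f3 a b by rewrite exchange_big.
clearbody f1 f2 f3.
under eq_bigr do rewrite big_split -mulr_suml sumrB !big_split /=.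
rewrite big_split -mulr_suml sumrB !big_split /= S2' S3' S1 S2 S3.
by field.
Qed.

End FiberLaplacian.

(** * The graph on an affine generalised quadrangle *)

Section QuadrangleGraph.
Variables (R : realType) (F : finFieldType) (e : F -> bool).
Hypothesis ch2 : 2%N \in [pchar F].
Hypothesis eD : {morph e : x y / x + y >-> x (+) y}.
Hypothesis e_neq0 : exists z, e z.

Let q : R := #|F|%:R.

Let q_gt0 : 0 < q.
Proof. by rewrite ltr0n; apply/card_gt0P; exists 0. Qed.

Definition sg (x : F) : R := (-1) ^+ e x.

Lemma e0 : e 0 = false.
Proof. by have := eD 0 0; rewrite addr0 addbb. Qed.

Lemma sgD x y : sg (x + y) = sg x * sg y.
Proof. by rewrite /sg eD signr_addb. Qed.

(** Orthogonality of characters: for [c != 0], shifting [k] by [z / c] with [e z] true flips every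
    sign. *)
Lemma sum_sg c : \sum_k sg (c * k) = q * (c == 0)%:R.
Proof.
have [->|c0] := eqVneq c 0.
  rewrite (eq_bigr (fun=> 1)) => [|k _]; first by rewrite sumr_const mulr1.
  by rewrite mul0r /sg e0.
rewrite mulr0; have [z ez] := e_neq0.
have : \sum_k sg (c * k) = - \sum_k sg (c * k).
  rewrite {1}(reindex_inj (addIr (z / c))) /= -sumrN; apply: eq_bigr => k _.
  rewrite mulrDr (mulrC c (_ / _)) divfK // sgD {2}/sg ez.
  by rewrite expr1 mulrN1.
by move=> /eqP; rewrite -addr_eq0 -mulr2n mulrn_eq0 /= => /eqP.
Qed.

Let addrr2 (x : F) : x + x = 0. Proof. exact: addrr_pchar2. Qed.

Lemma eqr_pchar2 (a b c d : F) : (a + b == c + d) = (a + c == b + d).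
Proof.
rewrite -subr_eq0 -[RHS]subr_eq0 !opprD !(oppr_pchar2 ch2).
by congr (_ == _); rewrite -!addrA; congr (_ + _); rewrite addrCA.
Qed.

(* Points [(x, u, v)] and lines [(k, l, m)] with [u + x k = l] and
   [v + x^2 k = m] form a bipartite graph of girth 8 (an affine part of a
   generalised quadrangle); the points of a line are adjacent when [e (x^3 k)] separates them. *)
Definition quad_rel : rel (F * F * F) := fun p p' =>
  [exists k, [&& p.1.2 + p'.1.2 == (p.1.1 + p'.1.1) * k,
    p.2 + p'.2 == (p.1.1 ^+ 2 + p'.1.1 ^+ 2) * k
    & e ((p.1.1 ^+ 3 + p'.1.1 ^+ 3) * k)]].

Lemma quad_sym : symmetric quad_rel.
Proof.
move=> p p'; apply: eq_existsb => k; rewrite (addrC p.1.2) (addrC p.1.1).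
by rewrite (addrC p.2) (addrC (p.1.1 ^+ 2)) (addrC (p.1.1 ^+ 3)).
Qed.

Lemma quad_rel_neq p p' : quad_rel p p' -> p.1.1 != p'.1.1.
Proof.
move=> /existsP[k /and3P[_ _]]; apply: contraTneq => ->.
by rewrite addrr2 mul0r e0.
Qed.

Lemma quad_irr : irreflexive quad_rel.
Proof.
move=> p; case: (boolP (quad_rel p p)) => // pp.
by have := quad_rel_neq pp; rewrite eqxx.
Qed.

(* The slopes [k1], [k2], [k3] of the sides satisfy a Vandermonde system, so
   they coincide, and a line carries no odd cycle. *)
Lemma quad_triangle_free p1 p2 p3 :
  ~ [/\ quad_rel p1 p2, quad_rel p2 p3 & quad_rel p1 p3].
Proof.
move=> [h12 h23 h13].
move: (quad_rel_neq h12) (quad_rel_neq h23) (quad_rel_neq h13).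
move: p1 p2 p3 h12 h23 h13 => [[x a] a'] [[y b] b'] [[z c] c'].
move=> /existsP[/= k1 /and3P[/eqP ab /eqP ab' e1]].
move=> /existsP[/= k2 /and3P[/eqP bc /eqP bc' e2]].
move=> /existsP[/= k3 /and3P[/eqP ac /eqP ac' e3]] xy yz xz.
have two : 2 = 0 :> F by rewrite (pcharf0 ch2).
have E1 : (x + y) * k1 + (y + z) * k2 = (x + z) * k3.
  by rewrite -ab -bc -ac -[RHS]addr0 -(addrr2 b); ring.
have E2 : (x ^+ 2 + y ^+ 2) * k1 + (y ^+ 2 + z ^+ 2) * k2 =
    (x ^+ 2 + z ^+ 2) * k3.
  by rewrite -ab' -bc' -ac' -[RHS]addr0 -(addrr2 b'); ring.
have neq0 s t : s != t -> s + t != 0 :> F.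
  by rewrite -{2}(oppr_pchar2 ch2 t) subr_eq0.
have k13 : k1 = k3.
  apply/eqP; rewrite -subr_eq0 (oppr_pchar2 ch2).
  have /eqP : (x + y) * (x + z) * (k1 + k3) = 0.
    (* Adding [y + z] times the first equation to the second eliminates [k2]; the multiple of 2
       makes this an identity that [ring] proves in any characteristic. *)
    have -> : (x + y) * (x + z) * (k1 + k3) =
        ((x ^+ 2 + y ^+ 2) * k1 + (y ^+ 2 + z ^+ 2) * k2 -
          (x ^+ 2 + z ^+ 2) * k3) +
        (y + z) * ((x + y) * k1 + (y + z) * k2 - (x + z) * k3) +
        2 * ((x ^+ 2 + x * y + x * z + y * z + z ^+ 2) * k3 - y ^+ 2 * k1 -
          (y ^+ 2 + y * z + z ^+ 2) * k2) by ring.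
    by rewrite E1 E2 two !subrr mulr0 mul0r !addr0.
  by rewrite !mulf_eq0 (negbTE (neq0 _ _ xy)) (negbTE (neq0 _ _ xz)).
have k23 : k2 = k3.
  apply: (mulfI (neq0 _ _ yz)); apply: (addrI ((x + y) * k1)); rewrite E1 k13.
  by rewrite -[LHS]addr0 -(addrr2 (y * k3)); ring.
move: e1 e2 e3; rewrite k13 k23.
(* On a common line the third sign is the sum of the other two, so the three cannot all be true. *)
have -> : (x ^+ 3 + z ^+ 3) * k3 =
    (x ^+ 3 + y ^+ 3) * k3 + (y ^+ 3 + z ^+ 3) * k3.
  by rewrite -[LHS]addr0 -(addrr2 (y ^+ 3 * k3)); ring.
by rewrite eD => -> ->.
Qed.

(** * Incidence matrices and the Gram factor *)

(** Indicator that one line of slope [k] contains both points; summing over [k] gives an entry of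
    [N N^T]. *)
Definition quad_inc (p : F * F * F) (k : F) (p' : F * F * F) : R :=
  (p.1.2 + p'.1.2 == (p.1.1 + p'.1.1) * k)%:R *
  (p.2 + p'.2 == (p.1.1 ^+ 2 + p'.1.1 ^+ 2) * k)%:R.

(** Entrywise form of [2 A = N N^T - S S^T]. Adjacent points have different first coordinates, so
    they share a single slope, and [1 - sg] is 2 there. *)
Lemma quad_relE p p' : 2 * (quad_rel p p')%:R =
  \sum_k quad_inc p k p' * (1 - sg ((p.1.1 ^+ 3 + p'.1.1 ^+ 3) * k)).
Proof.
have [/[dup] pp' /existsP[k /and3P[uk vk ek]]|] := boolP (quad_rel p p').
  rewrite (bigD1 k) //= /quad_inc uk vk /sg ek big1 => [|k' k'k].
    by rewrite !mul1r addr0 expr1 opprK mulr1.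
  have xy : p.1.1 + p'.1.1 != 0.
    by rewrite -(oppr_pchar2 ch2 p'.1.1) subr_eq0 quad_rel_neq.
  by rewrite (eqP uk) (inj_eq (mulfI xy)) eq_sym (negbTE k'k) !mul0r.
rewrite negb_exists => /forallP npp'; rewrite mulr0 big1 // => k _.
move: (npp' k); rewrite !negb_and /quad_inc /sg.
case: (_ == _) => /=; last by rewrite !mul0r.
case: (_ == _) => /=; last by rewrite mulr0 mul0r.
by move=> /negbTE ->; rewrite subrr mulr0.
Qed.

(** [a] and [b] are the Fourier frequencies dual to the coordinates [u] and [v] of a point. *)
Definition cubic (a b z : F) : F := z ^+ 3 + b * z ^+ 2 + a * z.

Lemma card_cubic_fiber a b c : (#|[pred z | cubic a b z == c]| <= 3)%N.
Proof.
pose p : {poly F} := 'X^3 + (b *: 'X^2 + a *: 'X - c%:P).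
have sp : size p = 4.
  rewrite size_polyDl size_polyXn // ltnS.
  rewrite (leq_trans (size_polyD _ _)) // geq_max size_polyN.
  rewrite (leq_trans (size_polyC_leq1 _)) // andbT.
  rewrite (leq_trans (size_polyD _ _)) // geq_max.
  rewrite (leq_trans (size_scale_leq _ _)) ?size_polyXn //.
  by rewrite (leq_trans (size_scale_leq _ _)) ?size_polyX.
have p0 : p != 0 by rewrite -size_poly_eq0 sp.
have := @max_poly_roots _ p (enum [pred z | cubic a b z == c]) p0.
rewrite -cardE sp ltnS; apply; last exact: enum_uniq.
apply/allP => z; rewrite mem_enum inE => /eqP zc.
rewrite /root !hornerE /= -zc /cubic expr2 mulrA subrr eqxx //.
Qed.

(** Left: the lines [(k, l, m)]. Right: a pair of frequencies with a coordinate of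
    [fiber_laplacian]. *)
Definition quad_index : finType := (F * F * F + (F * F) * (F * F))%type.

(* A Gram factor of [2 A + 3 q I = N N^T + (3 q I - S S^T)], [N] and [S] being
   the incidence matrix of the quadrangle and its signed version. *)
Definition quad_vec (p : F * F * F) (i : quad_index) : R :=
  match i with
  | inl (k, l, m) => (p.1.2 + p.1.1 * k == l)%:R * (p.2 + p.1.1 ^+ 2 * k == m)%:R
  | inr (a, b, j) => sg (a * p.1.2 + b * p.2) / Num.sqrt q *
      fiber_laplacian R 3 (cubic a b) p.1.1 j
  end.

(** The handle [c] before normalisation: every point lies on exactly one line of each slope, so its
    product with every vector is [q]. *)
Definition quad_handle (i : quad_index) : R := if i is inl _ then 1 else 0.

Lemma gram_quad_vec p p' : \sum_i quad_vec p i * quad_vec p' i =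
  2 * (quad_rel p p')%:R + 3 * q * (p == p')%:R.
Proof.
rewrite big_sumType /=.
have -> : \sum_i quad_vec p (inl i) * quad_vec p' (inl i) =
    \sum_k quad_inc p k p'.
  pose t k l m := quad_vec p (inl (k, l, m)) * quad_vec p' (inl (k, l, m)).
  rewrite (eq_bigr (fun i => t i.1.1 i.1.2 i.2)) => [|[[k l] m] _ //].
  rewrite -(pair_bigA _ (fun i m => t i.1 i.2 m)) /=.
  rewrite -(pair_bigA _ (fun k l => \sum_m t k l m)) /=; apply: eq_bigr => k _.
  rewrite (bigD1 (p.1.2 + p.1.1 * k)) //= [X in _ + X]big1 ?addr0.
    rewrite (bigD1 (p.2 + p.1.1 ^+ 2 * k)) //= big1 ?addr0.
      rewrite /t /= !eqxx !mul1r /quad_inc !mulrDl.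
      by congr ((nat_of_bool _)%:R * (nat_of_bool _)%:R);
        rewrite [RHS]eqr_pchar2 eq_sym.
    by move=> m /negbTE pm; rewrite /t /= eq_sym pm mulr0 mul0r.
  by move=> l /negbTE pl; rewrite big1 // => m _; rewrite /t /= eq_sym pl !mul0r.
(* The Fourier coordinates contribute the entry of [3 q I - S S^T]. *)
have -> : \sum_i quad_vec p (inr i) * quad_vec p' (inr i) =
   3 * q * (p == p')%:R -
   \sum_k quad_inc p k p' * sg ((p.1.1 ^+ 3 + p'.1.1 ^+ 3) * k).
  case: p p' => [[x u] v] [[y u'] v'] /=.
  have sqrq : Num.sqrt q ^+ 2 = q by rewrite sqr_sqrtr // ltW.
  have q0 : q != 0 by rewrite gt_eqF.
  pose s a b := sg (a * (u + u') + b * (v + v')).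
  have sg2 a b : sg (a * u + b * v) * sg (a * u' + b * v') = s a b.
    by rewrite -sgD; congr sg; ring.
  pose t a b := q^-1 * s a b *
    (3 * (x == y)%:R - (cubic a b x == cubic a b y)%:R).
  transitivity (\sum_a \sum_b t a b).
    rewrite (eq_bigr (fun i => quad_vec (x, u, v) (inr (i.1, i.2)) *
      quad_vec (y, u', v') (inr (i.1, i.2)))) => [|[] //].
    rewrite -(pair_bigA _ (fun i j => quad_vec (x, u, v) (inr (i, j)) *
      quad_vec (y, u', v') (inr (i, j)))) /= [RHS]pair_bigA.
    apply: eq_bigr => [[a b] _]; rewrite /t /=.
    rewrite -gram_fiber_laplacian => [|c]; last exact: card_cubic_fiber.
    rewrite mulr_sumr; apply: eq_bigr => j _.
    rewrite -sg2 -{3}sqrq -exprVn; ring.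
  have sum2 U V : \sum_a \sum_b sg (a * U + b * V) =
      q ^+ 2 * ((U == 0)%:R * (V == 0)%:R).
    under eq_bigr do under eq_bigr do rewrite sgD.
    under eq_bigr do rewrite -mulr_sumr.
    rewrite -mulr_suml; under eq_bigr do rewrite mulrC.
    under [X in _ * X]eq_bigr do rewrite mulrC.
    by rewrite !sum_sg; ring.
  have add_eq0 (a b : F) : (a + b == 0) = (a == b).
    by rewrite addr_eq0 (oppr_pchar2 ch2).
  have -> : \sum_a \sum_b t a b = 3 / q * (x == y)%:R * (\sum_a \sum_b s a b) -
      q^-1 * \sum_a \sum_b s a b * (cubic a b x == cubic a b y)%:R.
    rewrite !mulr_sumr -sumrB; apply: eq_bigr => a _.
    rewrite !mulr_sumr -sumrB; apply: eq_bigr => b _.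
    by rewrite /t; ring.
  congr (_ - _).
    rewrite sum2 !add_eq0 !xpair_eqE.
    by case: (x == y); case: (u == u'); case: (v == v'); rewrite /=; field.
  (* The indicator of equal cubic values is expanded as a character sum over [k]; regrouping by [a]
     and [b] lets [sum2] recover the two incidence equations. *)
  have -> : \sum_a \sum_b s a b * (cubic a b x == cubic a b y)%:R =
      q^-1 * \sum_a \sum_b \sum_k sg ((x ^+ 3 + y ^+ 3) * k) *
        sg (a * (u + u' + (x + y) * k) + b * (v + v' + (x ^+ 2 + y ^+ 2) * k)).
    rewrite mulr_sumr; apply: eq_bigr => a _.
    rewrite mulr_sumr; apply: eq_bigr => b _.
    rewrite -add_eq0 -(mulKf q0 (_ == _)%:R) -sum_sg mulrCA mulr_sumr.
    by congr (_ * _); apply: eq_bigr => k _; rewrite -!sgD /cubic; congr sg; ring.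
  under [in LHS]eq_bigr do rewrite exchange_big /=.
  rewrite exchange_big /= !mulr_sumr; apply: eq_bigr => k _.
  under eq_bigr do rewrite -mulr_sumr.
  rewrite -mulr_sumr sum2 !add_eq0 /quad_inc /=.
  by field.
rewrite quad_relE; under [in RHS]eq_bigr do rewrite mulrBr mulr1.
by rewrite sumrB; ring.
Qed.

Lemma quad_handle_vec p : \sum_i quad_handle i * quad_vec p i = q.
Proof.
rewrite big_sumType /= [X in _ + X]big1 ?addr0 => [|i _]; last by rewrite mul0r.
pose t k l m : R :=
  (p.1.2 + p.1.1 * k == l)%:R * (p.2 + p.1.1 ^+ 2 * k == m)%:R.
rewrite (eq_bigr (fun i => t i.1.1 i.1.2 i.2)) => [|[[k l] m] _]; last first.
  by rewrite mul1r.
rewrite -(pair_bigA _ (fun i m => t i.1 i.2 m)) /=.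
rewrite -(pair_bigA _ (fun k l => \sum_m t k l m)) /=.
rewrite (eq_bigr (fun=> 1)) => [|k _]; first by rewrite sumr_const.
have delta c : \sum_l (c == l)%:R = 1 :> R.
  rewrite (bigD1 c) //= eqxx big1 ?addr0 // => l /negbTE.
  by rewrite eq_sym => ->.
under eq_bigr do rewrite -mulr_sumr delta mulr1.
exact: delta.
Qed.

Lemma quad_handle_sqr : \sum_i quad_handle i ^+ 2 = q ^+ 3.
Proof.
rewrite big_sumType /= [X in _ + X]big1 ?addr0 => [|i _]; last by rewrite expr0n.
rewrite (eq_bigr (fun=> 1)) => [|i _]; last by rewrite expr1n.
by rewrite sumr_const !card_prod !natrM /q exprS expr2 mulrA.
Qed.

(** * Bounds for the Lovasz number of the doubled graph *)

Definition quad_graph := twin_graph quad_sym quad_irr.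

Lemma quad_graph_triangle_free : triangle_free quad_graph.
Proof.
move=> x y z [xy [yz xz]]; apply: quad_triangle_free.
by split; [exact: xy|exact: yz|exact: xz].
Qed.

(** The points with first coordinate 0, each with its twin, are independent because adjacent points
    differ in that coordinate. *)
Lemma quad_graph_theta_ge : 2 * q ^+ 2 <= lovasz_theta R quad_graph.
Proof.
pose f (t : F * F * bool) : 'I_#|{: F * F * F * bool}| :=
  enum_rank ((0 : F, t.1.1, t.1.2), t.2).
have f_inj : injective f by move=> [[u v] b] [[u' v'] b'] /enum_rank_inj[-> -> ->].
have -> : 2 * q ^+ 2 = #|f @: [set: F * F * bool]%SET|%:R.
  rewrite card_imset // cardsT !card_prod card_bool !natrM -/q; ring.
apply: lovasz_theta_ge_independent.
  by apply/card_gt0P; exists (0, 0, 0, true).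
move=> _ _ /imsetP[t _ ->] /imsetP[t' _ ->].
have -> : quad_graph (f t) (f t') =
    quad_rel (0, t.1.1, t.1.2) (0, t'.1.1, t'.1.2).
  by rewrite /= /f !enum_rankK.
by apply/negP => h; have := quad_rel_neq h; rewrite eqxx.
Qed.

Lemma quad_graph_theta_le : lovasz_theta R quad_graph <= 6 * q ^+ 2.
Proof.
have -> : 6 * q ^+ 2 = (3 * q) * (2 * q ^+ 3) / q ^+ 2.
  by field; rewrite gt_eqF.
(* Twins are non-adjacent, so they get orthogonal copies of the same vector. The handle covers both
   copies, which doubles its squared norm to [2 q^3] and leaves its products equal to [q]. *)
pose W (p : F * F * F * bool) (i : quad_index * bool) : R :=
  quad_vec p.1 i.1 * (p.2 == i.2)%:R.
pose C (i : quad_index * bool) : R := quad_handle i.1.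
have sumW p p' : \sum_i W p i * W p' i =
    (2 * (quad_rel p.1 p'.1)%:R + 3 * q * (p.1 == p'.1)%:R) * (p.2 == p'.2)%:R.
  rewrite -(pair_bigA _ (fun i b => W p (i, b) * W p' (i, b))) /=.
  rewrite -gram_quad_vec mulr_suml; apply: eq_bigr => i _.
  rewrite big_bool /W /=.
  by case: p.2; case: p'.2; rewrite /=; ring.
apply: (@lovasz_theta_le _ _ _ _ _ _ W C); rewrite ?mulr_gt0 ?exprn_gt0 //.
- by apply/card_gt0P; exists (0, 0, 0, true).
- move=> p; under eq_bigr do rewrite expr2.
  by rewrite sumW quad_irr !eqxx; rewrite ?mulr1n ?mulr0n; ring.
- move=> [a b] [a' b'] neq; rewrite sumW /twin_rel /= => /negbTE ->.
  move: neq; rewrite xpair_eqE negb_and mulr0 add0r.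
  by case: (a == a'); case: (b == b') => //= _; rewrite ?mulr0 ?mul0r.
- rewrite -(pair_bigA _ (fun i (b : bool) => quad_handle i ^+ 2)) /=.
  rewrite -quad_handle_sqr mulr_sumr; apply: eq_bigr => i _.
  by rewrite big_bool /=; ring.
- move=> p; rewrite -(pair_bigA _ (fun i b => C (i, b) * W p (i, b))) /=.
  rewrite -(quad_handle_vec p.1); apply: eq_bigr => i _.
  by rewrite big_bool /C /W /=; case: p.2; rewrite /=; ring.
Qed.

End QuadrangleGraph.

(** * Common vertex counts and the asymptotics *)

Lemma exists_theta_graph (R : realType) k (q := (2 ^ k.+1)%N) :
  exists G : sgraph (2 ^ (3 * k + 4)), [/\ triangle_free G,
    2 * q%:R ^+ 2 <= lovasz_theta R G, lovasz_theta R G <= 6 * q%:R ^+ 2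
    & \rank (adjmx R G + 1%:M)%R = (2 ^ (3 * k + 4))%N].
Proof.
have [F ch2 cardF] := pPrimePowerField (isT : prime 2) (ltn0Sn k).
have [e eD e1] := exists_additive_sign ch2 cardF.
have cardV : #|{: F * F * F * bool}| = (2 ^ (3 * k + 4))%N.
  rewrite !card_prod card_bool cardF -!expnD -expnSr; congr (2 ^ _)%N; lia.
have [G] : exists G : sgraph #|{: F * F * F * bool}|, [/\ triangle_free G,
    2 * q%:R ^+ 2 <= lovasz_theta R G, lovasz_theta R G <= 6 * q%:R ^+ 2
    & \rank (adjmx R G + 1%:M)%R = #|{: F * F * F * bool}|].
  exists (quad_graph ch2 eD); rewrite /q -cardF; split.
  - exact: quad_graph_triangle_free.
  - exact: quad_graph_theta_ge.
  - exact: quad_graph_theta_le.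
  - exact: rank_twin_graph.
by rewrite cardV in G *; exists G.
Qed.

Lemma exists_msr_graph (R : realType) k (n := (2 ^ (3 * k + 4))%N) :
  exists G : sgraph n, triangle_free G /\
    `|(\rank (adjmx R G + 1%:M)%R)%:R - 3 / 8 * n%:R| <= 16 :> R.
Proof.
have nE : n = (16 * 2 ^ (3 * k))%N by rewrite /n expnD mulnC.
rewrite nE; exists (tensor_clebsch _).
split; first exact: tensor_clebsch_triangle_free.
have [] := rank_tensor_clebsch R (2 ^ (3 * k)).
set r := \rank _; rewrite -!(ler_nat R) !(natrD _ _ 16) !natrM => h1 h2.
by rewrite ler_norml; apply/andP; split; lra.
Qed.

Theorem theorem6p2 (R : realType) :
  exists (S : set nat) (G1 G2 : forall n : nat, sgraph n),
    [/\ infinite_set S,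
        (forall n, S n ->
          [/\ (1 < n)%N, triangle_free (G1 n) & triangle_free (G2 n)]),
        ((fun n => lovasz_theta R (G1 n))
            \is 'Theta_(within S \oo) (fun n => n%:R `^ (2 / 3))) /\
        (forall n, S n -> \rank (adjmx R (G1 n) + 1%:M)%R = n)
      & (forall n, S n -> (n%:R / 2 : R) <= (msr R (G2 n))%:R) /\
        ((\rank (adjmx R (G2 n) + 1%:M)%R)%:R / n%:R : R)
            @[n --> within S \oo] --> (3 / 8 : R)].
Proof.
(* This number is both [2 q^3] with [q = 2^(k+1)] and [16 s] with [s = 2^(3k)], so both
   constructions exist at each order. *)
pose order k := (2 ^ (3 * k + 4))%N; pose S : set nat := range order.
(* Filler value of the two families outside [S]. *)
have empty n : sgraph n by exists (fun _ _ => false).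
have theta_graph n : {G : sgraph n | S n -> [/\ triangle_free G,
    n%:R `^ (2 / 3) <= 2 * lovasz_theta R G,
    lovasz_theta R G <= 6 * n%:R `^ (2 / 3)
    & \rank (adjmx R G + 1%:M)%R = n]}.
  apply: cid; case: (pselect (S n)) => [|?]; last by exists (empty n).
  move=> [k _ <-]; have [G [tfG]] := exists_theta_graph R k.
  set q : R := (2 ^ k.+1)%:R => ge le rkG; exists G => _.
  have q0 : 0 <= q by rewrite ler0n.
  have pow23 (x : R) : 0 <= x -> (x ^+ 3) `^ (2 / 3) = x ^+ 2.
    move=> x0; rewrite -powR_mulrn // -powRrM -powR_mulrn //.
    by congr (_ `^ _); field.
  have nE : (order k)%:R = 2 * q ^+ 3 :> R.
    rewrite /q -natrX -natrM -expnM -expnS; congr (_ ^ _)%:R; lia.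
  split=> //.
  (* Since [n = 2 q^3] lies between [q^3] and [(2 q)^3], [n^(2/3)] lies between [q^2] and
     [4 q^2]. *)
  - apply: (@le_trans _ _ ((2 * q) ^+ 2)); last by rewrite exprMn; lra.
    rewrite -pow23 ?mulr_ge0 // ge0_ler_powR // ?nnegrE ?exprn_ge0 ?mulr_ge0 //.
    by rewrite nE exprMn ler_wpM2r ?exprn_ge0 //; lra.
  - apply: (le_trans le); rewrite ler_wpM2l // -pow23 //.
    rewrite ge0_ler_powR // ?nnegrE ?exprn_ge0 // nE.
    by rewrite ler_peMl ?exprn_ge0 // ler1n.
have msr_graph n : {G : sgraph n | S n -> triangle_free G /\
    `|(\rank (adjmx R G + 1%:M)%R)%:R - 3 / 8 * n%:R| <= 16 :> R}.
  apply: cid; case: (pselect (S n)) => [|?]; last by exists (empty n).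
  by move=> [k _ <-]; have [G PG] := exists_msr_graph R k; exists G.
have S_gt1 n : S n -> (1 < n)%N.
  by move=> [k _ <-]; rewrite -[1%N](expn0 2) ltn_exp2l // addn4.
exists S, (fun n => sval (theta_graph n)), (fun n => sval (msr_graph n)); split.
- move=> finS; apply: infinite_nat.
  have -> : setT = order @^-1` S by apply/seteqP; split=> // k _; exists k.
  apply: finite_preimage finS => i j _ _ /eqP.
  by rewrite eqn_exp2l // eqn_add2r eqn_mul2l => /eqP.
- move=> n Sn; split; first exact: S_gt1.
  + by case: (theta_graph n) => G /= /(_ Sn)[].
  + by case: (msr_graph n) => G /= /(_ Sn)[].
- split; last by move=> n Sn; case: (theta_graph n) => G /= /(_ Sn)[].
  rewrite qualifE; apply/asboolP; exists (2^-1, 6).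
    by rewrite /= invr_gt0 !ltr0n.
  rewrite near_withinE; apply: nearW => n Sn.
  case: (theta_graph n) => G /= /(_ Sn)[_ ge le _].
  have n0 := powR_ge0 (n%:R : R) (2 / 3).
  rewrite !ger0_norm //; first by split; lra.
  by lra.
- split=> [n Sn|].
    by apply: msr_triangle_free; case: (msr_graph n) => G /= /(_ Sn)[].
  apply/cvgrPdist_le => eps eps0; rewrite near_withinE.
  near=> n => Sn; have n1 : (0 < n%:R :> R) by rewrite ltr0n ltnW // S_gt1.
  case: (msr_graph n) => G /= /(_ Sn)[_]; set r := (\rank _)%:R => rn.
  have -> : 3 / 8 - r / n%:R = - (r - 3 / 8 * n%:R) / n%:R.
    by field; rewrite gt_eqF.
  rewrite normrM normrN normfV (gtr0_norm n1) ler_pdivrMr //.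
  (* The ratio differs from 3/8 by at most [16 / n], so [n >= 16 / eps] suffices. *)
  apply: (le_trans rn); rewrite -ler_pdivrMl // mulrC.
  by near: n; exact: nbhs_infty_ger.
Unshelve. all: by end_near. Qed.
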